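(* Let $(X_1,\mu_1),\ldots,(X_n,\mu_n)$ be $\sigma$-finite measure spaces with product $(X,\mu)$. Let $0<k<n$ be integers, $M=\binom nk$, and let $S_1,\ldots,S_M$ enumerate the size-$k$ subsets of $\{1,\ldots,n\}$. Let $q_1,\ldots,q_M$ be positive (possibly infinite) exponents such that $\sum_{i=1}^M\frac1{q_i}\le1$, and define $\epsilon=1-\sum_{i=1}^M\frac1{q_i}\ge0$. Then for any nonnegative numbers $c_1,\ldots,c_M$ such that, for each $j\in\{1,\ldots,n\}$, $$\sum_{i\,:\,S_i\ni j}c_i=1,$$ and any nonnegative $\mu$-measurable functions $f_1,\ldots,f_M$ on $X$, $$\int_X f_1\cdots f_M\,d\mu\le\prod_{i=1}^M\left(\int_{S_i}\left(\int_{\sim S_i}f_i^{q_i}\right)^{p_i/q_i}\right)^{1/p_i},$$ where $\frac1{p_i}=\frac1{q_i}+c_i\epsilon$.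
   Context: For $E\subset\{1,\ldots,n\}$, $\int_E$ denotes integration over the product of those $X_j$ with $j\in E$ (with respect to the product of the corresponding $\mu_j$), and $\sim E=\{1,\ldots,n\}\setminus E$. Thus the $i$-th factor on the right is the $L^{p_i}$ norm over $\prod_{j\in S_i}X_j$ of the $L^{q_i}$ norm of $f_i$ over $\prod_{j\notin S_i}X_j$. When an exponent $q_i$ or $p_i$ is infinite, the corresponding $L^\infty$ norm (essential supremum) replaces the integral expression. Convention: $1/\infty=0$. *)

(* Defs.v *)
From HB Require Import structures.
From mathcomp Require Import all_boot all_order all_algebra.
From mathcomp Require Import all_classical all_reals all_analysis.

Set Implicit Arguments.
Unset Strict Implicit.
Unset Printing Implicit Defensive.

Import Order.TTheory GRing.Theory Num.Theory.

Local Open Scope classical_set_scope.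
Local Open Scope ring_scope.
Local Open Scope ereal_scope.

(* Families of points, with the sigma-algebra generated by the coordinates. *)
Definition product_space (I : finType) (d : I -> measure_display)
  (X : forall i, measurableType (d i)) : Type := forall i, X i.

Definition product_display (I : finType) :
  (I -> measure_display) -> measure_display.
Proof. by move=> _; exact: default_measure_display. Qed.

Section product_sigma_algebra.
Context (I : finType) (d : I -> measure_display).
Variable X : forall i, measurableType (d i).

Definition cylinders : set (set (product_space X)) :=
  \bigcup_(i in [set: I])
    preimage_set_system setT (fun x : product_space X => x i) measurable.

Definition product_sigma_algebra : set (set (product_space X)) :=
  <<s cylinders >>.

HB.instance Definition _ := Pointed.copy (product_space X) (forall i, X i).

Let psa0 : product_sigma_algebra set0.
Proof. exact: sigma_algebra0. Qed.

Let psaC A : product_sigma_algebra A -> product_sigma_algebra (~` A).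
Proof. exact: sigma_algebraC. Qed.

Let psaU (F : (set (product_space X))^nat) :
  (forall i, product_sigma_algebra (F i)) ->
  product_sigma_algebra (\bigcup_i F i).
Proof. exact: sigma_algebra_bigcup. Qed.

HB.instance Definition _ := @isMeasurable.Build (product_display d)
  (product_space X) product_sigma_algebra psa0 psaC psaU.

Definition box (A : forall i, set (X i)) : set (product_space X) :=
  [set x | forall i, A i (x i)].

Lemma measurable_coord i :
  measurable_fun [set: product_space X] (fun x => x i).
Proof.
move=> _ A mA; apply: sub_sigma_algebra; exists i => //.
by exists A.
Qed.

Lemma measurable_fun_product d' (T : measurableType d')
    (g : T -> product_space X) :
  (forall i, measurable_fun setT (fun t => g t i)) -> measurable_fun setT g.
Proof.
move=> mg; apply: (@measurability _ _ _ _ _ _ cylinders) => //.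
move=> _ [_ [i _ [A mA <-]] <-].
by have := mg i measurableT A mA; rewrite !setTI.
Qed.

Lemma measurable_box A : (forall i, measurable (A i)) -> measurable (box A).
Proof.
move=> mA.
have -> : box A = \bigcap_(i in [set: I])
    ((fun x : product_space X => x i) @^-1` A i).
  by apply/seteqP; split => [x Ax i _|x Ax i]; exact: Ax.
apply: fin_bigcap_measurable => // i _.
by rewrite -[X in measurable X]setTI; exact: measurable_coord.
Qed.

End product_sigma_algebra.

Lemma sigma_finite_packed (R : realType) d (T : measurableType d)
    (m : {measure set T -> \bar R}) : sigma_finite setT m ->
  exists m' : {sigma_finite_measure set T -> \bar R}, forall A, m' A = m A.
Proof.
move=> sf.
pose H1 := isSFinite.Build _ _ _ (Measure.sort m)
  (sfinite_measure_sigma_finite sf).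
pose H2 := isSigmaFinite.Build _ _ _ (Measure.sort m) sf.
pose m' := HB.pack_for {sigma_finite_measure set T -> \bar R}
  (Measure.sort m) H1 H2.
by exists m'.
Qed.

Section product_measure_existence.
Context (R : realType) (I : finType) (d : I -> measure_display).
Variable X : forall i, measurableType (d i).
Variable mu : forall i, {sigma_finite_measure set (X i) -> \bar R}.

Let covers : exists F : forall i, (set (X i))^nat, forall i,
  [/\ setT = \bigcup_k F i k, nondecreasing_seq (F i) &
      forall k, measurable (F i k) /\ mu i (F i k) < +oo].
Proof.
exists (fun i => projT1 (cid ((sigma_finiteP setT (mu i)).1
  (sigma_finiteT (mu i))))) => i.
exact: projT2 (cid ((sigma_finiteP setT (mu i)).1 (sigma_finiteT (mu i)))).
Qed.

Lemma box_exhaustion : exists B : nat -> forall i, set (X i),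
  [/\ forall k i, measurable (B k i),
      forall k i, mu i (B k i) < +oo &
      \bigcup_k box (B k) = setT].
Proof.
have [F hF] := covers.
exists (fun k i => F i k); split => [k i|k i|].
- by have [_ _ /(_ k)[]] := hF i.
- by have [_ _ /(_ k)[]] := hF i.
- apply/seteqP; split => // x _.
  have /choice[K hK] : forall i, exists k, F i k (x i).
    move=> i; have [cF _ _] := hF i.
    have : setT (x i) by [].
    by rewrite cF => -[k _ Fk]; exists k.
  exists (\max_i K i)%N => // i.
  have [_ /(_ (K i) (\max_i K i)%N) ndF _] := hF i.
  by have /subsetPset := ndF (leq_bigmax i); apply.
Qed.

(* The coordinates in [s] carry their measure, those outside [s] are frozen at
   the distinguished point of their space. *)
Let partial_product (s : seq I) (m : set (product_space X) -> \bar R) :=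
  forall A, (forall i, measurable (A i)) ->
    m (box A) = \prod_i (if i \in s then mu i (A i) else \d_point (A i)).

Let partial_product_sigma_finite s
    (m : {measure set (product_space X) -> \bar R}) :
  partial_product s m -> sigma_finite setT m.
Proof.
move=> hm; have [B [mB Boo Bcov]] := box_exhaustion.
exists (fun k => box (B k)); first by rewrite Bcov.
move=> k; split; first exact: measurable_box.
rewrite hm// ltey_eq; apply/orP; left.
apply: prode_fin_num => i _; case: ifP => _.
  by rewrite ge0_fin_numE//; exact: Boo.
by rewrite diracE.
Qed.

Let partial_product_exists (s : seq I) : uniq s ->
  exists m : {sigma_finite_measure set (product_space X) -> \bar R},
    partial_product s m.
Proof.
suff ex_measure : uniq s -> exists m : {measure set (product_space X) -> \bar R},
    partial_product s m.
  move=> /ex_measure[m hm].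
  have [m' m'E] := sigma_finite_packed (partial_product_sigma_finite hm).
  by exists m' => A mA; rewrite m'E hm.
elim: s => [_|j s IH /= /andP[js us]].
  exists (dirac (point : product_space X)) => A mA.
  rewrite /= diracE; under eq_bigr do rewrite diracE.
  have [pA|pA] := boolP (point \in box A).
    rewrite big1// => i _; rewrite mem_set//.
    by move: pA => /set_mem; apply.
  have /existsNP[i piA] : ~ forall i, A i ((point : product_space X) i).
    by move=> h; move/negP: pA; apply; apply/mem_set.
  rewrite (bigD1 i)//= memNset ?mul0e//.
have [m hm] := IH us.
have [{}m {}hm] : exists m' : {sigma_finite_measure set (product_space X) -> \bar R},
    partial_product s m'.
  have [m' m'E] := sigma_finite_packed (partial_product_sigma_finite hm).
  by exists m' => A mA; rewrite m'E hm.
pose g (ty : X j * product_space X) : product_space X :=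
  eqtype.dfwith (ty.2 : forall i, X i) ty.1.
have mg : measurable_fun setT g.
  apply: measurable_fun_product => i; rewrite /g.
  have [<-|ji] := eqVneq j i.
    by under eq_fun do rewrite dfwith_in; exact: measurable_fst.
  under eq_fun do rewrite dfwith_out//.
  exact: (measurableT_comp (@measurable_coord _ _ X i) measurable_snd).
exists (measure_function_pushforward__canonical__measure_function_Measure
  (mu j \x m)%E mg) => A mA.
pose A' : forall i, set (X i) := eqtype.dfwith A [set: X j].
have mA' i : measurable (A' i).
  by rewrite /A'; case: eqtype.dfwithP.
have gA : g @^-1` box A = A j `*` box A'.
  apply/seteqP; split=> [[t y] gA|[t y] [/= At A'y] i].
    split => [|i]; first by have := gA j; rewrite /g dfwith_in.
    rewrite /A'; have [<-|ji] := eqVneq j i; first by rewrite dfwith_in.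
    by rewrite dfwith_out//; have := gA i; rewrite /g dfwith_out.
  rewrite /g; have [<-|ji] := eqVneq j i; first by rewrite dfwith_in.
  by rewrite dfwith_out//; have := A'y i; rewrite /A' dfwith_out.
rewrite /= /pushforward gA product_measure1E//; last exact: measurable_box.
rewrite hm// [in LHS](bigD1 j)//= [in RHS](bigD1 j)//=.
rewrite (negbTE js) mem_head /A' dfwith_in diracT mul1e; congr (_ * _).
apply: eq_bigr => i ij.
by rewrite in_cons (negbTE ij)/= dfwith_out// eq_sym.
Qed.

Lemma product_measure_exists :
  exists m : {sigma_finite_measure set (product_space X) -> \bar R},
    forall A, (forall i, measurable (A i)) ->
      m (box A) = \prod_i mu i (A i).
Proof.
have [m hm] := partial_product_exists (enum_uniq I).
exists m => A mA; rewrite hm//.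
by apply: eq_bigr => i _; rewrite mem_enum.
Qed.

Lemma product_measure_uniq
    (m1 m2 : {measure set (product_space X) -> \bar R}) :
  (forall A, (forall i, measurable (A i)) -> m1 (box A) = \prod_i mu i (A i)) ->
  (forall A, (forall i, measurable (A i)) -> m2 (box A) = \prod_i mu i (A i)) ->
  forall E, measurable E -> m1 E = m2 E.
Proof.
move=> h1 h2 E mE.
pose G := [set box A | A in
  [set A : forall i, set (X i) | forall i, measurable (A i)]].
have [B [mB Boo Bcov]] := box_exhaustion.
apply: (@g_sigma_algebra_measure_unique _ R _ G _ (fun k => box (B k))) => //.
- by move=> _ [A mA <-]; exact: measurable_box.
- by move=> k; exists (B k).
- move=> _ _ [A mA <-] [A' mA' <-]; exists (fun i => A i `&` A' i).
    by move=> i; exact: measurableI.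
  apply/seteqP; split => [x AA'x|x [Ax A'x] i]; last by split.
  by split => i; have [] := AA'x i.
- by move=> _ [A mA <-]; rewrite h1// h2.
- move=> k; rewrite h1// ltey_eq; apply/orP; left.
  by apply: prode_fin_num => i _; rewrite ge0_fin_numE//; exact: Boo.
- suff GE : <<s @cylinders I d X >> `<=` <<s G >> by exact: GE.
  apply: sub_sigma_algebra2 => _ [i _ [A mA <-]].
  exists (eqtype.dfwith (fun i' => [set: X i']) A).
    by move=> i'; case: eqtype.dfwithP.
  apply/seteqP; split => [x /(_ i)|x [_ Axi] i'].
    by rewrite dfwith_in; split.
  by case: eqtype.dfwithP.
Qed.

End product_measure_existence.

(* Chosen by [cid] from [product_measure_exists]; by [product_measureE] and
   [product_measure_uniq] it is the unique measure giving every measurable box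
   the product of the measures of its sides. *)
Definition product_measure (R : realType) (I : finType)
    (d : I -> measure_display) (X : forall i, measurableType (d i))
    (mu : forall i, {sigma_finite_measure set (X i) -> \bar R}) :
    {sigma_finite_measure set (product_space X) -> \bar R} :=
  projT1 (cid (product_measure_exists mu)).

Lemma product_measureE (R : realType) (I : finType)
    (d : I -> measure_display) (X : forall i, measurableType (d i))
    (mu : forall i, {sigma_finite_measure set (X i) -> \bar R})
    (A : forall i, set (X i)) : (forall i, measurable (A i)) ->
  product_measure mu (box A) = \prod_i mu i (A i).
Proof. exact: (projT2 (cid (product_measure_exists mu))). Qed.

Section mixed_norm.
Context (R : realType) (I : finType) (d : I -> measure_display).
Variable X : forall i, measurableType (d i).
Variable mu : forall i, {sigma_finite_measure set (X i) -> \bar R}.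
Implicit Type E : {set I}.

Definition subproduct E :=
  product_space (fun j : {j : I | j \in E} => X (val j)).

Definition subproduct_measure E :=
  product_measure (fun j : {j : I | j \in E} => mu (val j)).

(* The point whose coordinates in [E] are those of [y] and whose coordinates
   outside [E] are those of [z]. *)
Definition glue E (y : subproduct E) (z : subproduct (~: E)) :
    product_space X :=
  fun j => match boolP (j \in E) with
           | AltTrue jE => y (Sub j jE)
           | AltFalse jE => z (Sub j (introT setCP (elimN idP jE)))
           end.

(* The L^p norm over the coordinates in [E] of the L^q norm over the others.
   At an infinite exponent [Lnorm] is the essential supremum, or [0]
   if the measure is zero. *)
Definition mixed_norm E (q p : \bar R) (f : product_space X -> \bar R) :
    \bar R :=
  Lnorm (subproduct_measure E) p
    (fun y => Lnorm (subproduct_measure (~: E)) q (fun z => f (glue y z))).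

End mixed_norm.

(* Main.v *)
Require Import Defs.
From mathcomp Require Import all_boot all_order all_algebra.
From mathcomp Require Import all_classical all_reals all_analysis.
From mathcomp Require Import measurable_realfun ess_sup_inf.

Set Implicit Arguments.
Unset Strict Implicit.
Unset Printing Implicit Defensive.

Import Order.TTheory GRing.Theory Num.Theory.

Local Open Scope classical_set_scope.
Local Open Scope ring_scope.
Local Open Scope ereal_scope.

(** Let [g i] be the inner norm of [f i], a function of the coordinates in
    [S i], and let [N i] be the mixed norm.  When [q i] is finite, almost
    everywhere [f i] is at most
    [u i `^ (q i)^-1 * (g i `^ p i) `^ (c i * eps)] with
    [u i = f i `^ q i * g i `^ (p i - q i)], and both [u i] and [g i `^ p i]
    have integral [N i `^ p i]; when [q i] is infinite, [f i <= g i] almost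
    everywhere and the factor [u i] is not needed.  So the theorem reduces to
    Finner's inequality for the [u i], which depend on all coordinates and have
    weight [(q i)^-1], together with the [g i `^ p i], which depend on the
    coordinates in [S i] and have weight [c i * eps]: at each coordinate the
    weights add up to [1].  Finner's inequality is obtained by applying
    Hölder's inequality for several functions to one coordinate at a time. *)

(** * Weighted products of nonnegative functions *)

Lemma prode_eq0 (R : realDomainType) (K : finType) (x : K -> \bar R) k :
  x k = 0 -> \prod_i x i = 0.
Proof. by move=> xk0; rewrite (bigD1 k)//= xk0 mul0e. Qed.

Lemma prode_gt0 (R : realDomainType) (K : finType) (P : pred K)
    (x : K -> \bar R) :
  (forall k, P k -> 0 < x k) -> 0 < \prod_(k | P k) x k.
Proof.
by move=> x0; elim/big_ind : _ => // *; exact: mule_gt0.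
Qed.

Lemma prode_eqy (R : realDomainType) (K : finType) (x : K -> \bar R) k :
  (forall i, 0 < x i) -> x k = +oo -> \prod_i x i = +oo.
Proof.
by move=> x0 xky; rewrite (bigD1 k)//= xky gt0_mulye//; exact: prode_gt0.
Qed.

Lemma lee_prod (R : realDomainType) (K : finType) (x y : K -> \bar R) :
  (forall k, 0 <= x k <= y k) -> \prod_k x k <= \prod_k y k.
Proof.
move=> xy; suff /andP[] : 0 <= \prod_k x k <= \prod_k y k by [].
elim/big_ind2 : _ => // [|a b c d /andP[a0 ab] /andP[c0 cd]].
  by rewrite lexx andbT; exact: lee01.
by rewrite mule_ge0//= lee_pmul.
Qed.

Lemma emeasurable_prod (d : measure_display) (T : measurableType d)
    (R : realType) (K : finType) (F : K -> T -> \bar R) :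
  (forall k, measurable_fun setT (F k)) ->
  measurable_fun setT (fun x => \prod_k F k x).
Proof.
move=> mF; elim: (index_enum K) => [|k s IH].
  by under eq_fun do rewrite big_nil; exact: measurable_cst.
under eq_fun do rewrite big_cons; exact: emeasurable_funM.
Qed.

Lemma emeasurable_poweR (d : measure_display) (T : measurableType d)
    (R : realType) (F : T -> \bar R) (r : R) :
  measurable_fun setT F -> measurable_fun setT (fun x => F x `^ r).
Proof. by move=> mF; apply: (measurableT_comp (measurable_poweR r)). Qed.

Lemma amgm_expR (R : realType) (K : finType) (w t : K -> R) :
  (forall k, 0 <= w k)%R -> (\sum_k w k = 1)%R ->
  (expR (\sum_k w k * t k) <= \sum_k w k * expR (t k))%R.
Proof.
move=> w0 w1; set m := (\sum_k w k * t k)%R.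
(* Average the tangent line bounds [exp t >= exp m * (1 + (t - m))]. *)
have -> : expR m = (\sum_k w k * (expR m * (1 + (t k - m))))%R.
  under eq_bigr do rewrite mulrCA mulrDr mulr1 mulrBr.
  rewrite -mulr_sumr big_split/= sumrB -mulr_suml -/m.
  by rewrite w1 mul1r subrr addr0 mulr1.
apply: ler_sum => k _; apply: ler_wpM2l => //.
rewrite -[leRHS](@divfK _ (expR m)) ?gt_eqF ?expR_gt0// -expRN -expRD mulrC.
by rewrite ler_pM2r ?expR_gt0// expR_ge1Dx.
Qed.

(** The real inequality [amgm_expR] applies after taking logarithms, once values [0] and [+oo] of
    positive weight are set aside: the first makes the left side [0], the second makes the right
    side [+oo]. *)
Lemma amgm_poweR (R : realType) (K : finType) (w : K -> R) (x : K -> \bar R) :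
  (forall k, 0 <= w k)%R -> (\sum_k w k = 1)%R -> (forall k, 0 <= x k) ->
  \prod_k x k `^ w k <= \sum_k (w k)%:E * x k.
Proof.
move=> w0 w1 x0.
have s0 (P : pred K) : 0 <= \sum_(k | P k) (w k)%:E * x k.
  by apply: sume_ge0 => k _; rewrite mule_ge0 ?lee_fin.
have [[k wk xk]|Nxy] := pselect (exists2 k, (0 < w k)%R & x k = +oo).
  rewrite [leRHS](bigD1 k)//= xk gt0_muley ?lte_fin// addye ?leey//.
  by rewrite gt_eqF// (lt_le_trans ltNy0).
have [[k wk xk]|Nx0] := pselect (exists2 k, (0 < w k)%R & x k = 0).
  by rewrite (@prode_eq0 _ _ _ k) ?s0// xk poweR0r// gt_eqF.
(* Where [w k = 0], [t k] may be meaningless, but then it is multiplied by [0] and the factor of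
   index [k] on the left is [1]. *)
pose t k := ln (fine (x k)).
have xE k : (0 < w k)%R -> x k = (expR (t k))%:E.
  move=> wk; have : x k != 0 by apply: contra_notN Nx0 => /eqP; exists k.
  have : x k != +oo by apply: contra_notN Nxy => /eqP; exists k.
  rewrite /t; case: (x k) (x0 k) => //= r; rewrite lee_fin eqe => r0 _ rN0.
  by rewrite lnK// posrE lt_def rN0.
have -> : \prod_k x k `^ w k = (expR (\sum_k w k * t k))%:E.
  rewrite expR_sum -prodEFin; apply: eq_bigr => k _.
  have := w0 k; rewrite le_eqVlt => /predU1P[<-|wk].
    by rewrite poweRe0 mul0r expR0.
  by rewrite (xE _ wk) poweR_EFin -expRM mulrC.
have -> : \sum_k (w k)%:E * x k = (\sum_k w k * expR (t k))%:E.
  rewrite -sumEFin; apply: eq_bigr => k _.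
  have := w0 k; rewrite le_eqVlt => /predU1P[<-|wk].
    by rewrite mul0e mul0r.
  by rewrite xE.
by rewrite lee_fin amgm_expR.
Qed.

(** Divide each [F k] by its integral, apply the weighted arithmetic-geometric inequality pointwise
    and integrate: the normalised functions contribute their weights, which add up to [1]. *)
Lemma hoelder_prod (d : measure_display) (T : measurableType d) (R : realType)
    (mu : {measure set T -> \bar R}) (K : finType) (w : K -> R)
    (F : K -> T -> \bar R) :
  (forall k, 0 <= w k)%R -> (\sum_k w k = 1)%R ->
  (forall k, measurable_fun setT (F k)) -> (forall k x, 0 <= F k x) ->
  \int[mu]_x (\prod_k F k x `^ w k) <= \prod_k (\int[mu]_x F k x) `^ w k.
Proof.
move=> w0 w1 mF F0.
pose I k := \int[mu]_x F k x.
have I0 k : 0 <= I k by exact: integral_ge0.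
have mP : measurable_fun setT (fun x => \prod_k F k x `^ w k).
  by apply: emeasurable_prod => k; exact: emeasurable_poweR.
have P0 x : 0 <= \prod_k F k x `^ w k.
  by apply: prode_ge0 => k _; exact: poweR_ge0.
(* A zero integral of positive weight makes [F k], hence the whole integrand, vanish almost
   everywhere. *)
have [[k wk Ik]|NI0] := pselect (exists2 k, (0 < w k)%R & I k = 0).
  rewrite (ge0_ae_eq_integral (g := cst 0))//.
    by rewrite integral0 prode_ge0// => i _; exact: poweR_ge0.
  have /(ae_eq_integral_abs mu measurableT (mF k)) : \int[mu]_x `|F k x| = 0.
    by rewrite -[RHS]Ik; apply: eq_integral => x _; rewrite gee0_abs.
  apply: filterS => x /= Fk0 _.
  by apply: (@prode_eq0 _ _ _ k); rewrite Fk0// poweR0r// gt_eqF.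
(* With all factors on the right positive, an infinite one makes the product infinite, in spite of
   the convention [0 * +oo = 0]. *)
have Iw0 k : 0 < I k `^ w k.
  have := w0 k; rewrite le_eqVlt => /predU1P[<-|wk]; first by rewrite poweRe0.
  apply: poweR_gt0; rewrite lt_def I0 andbT.
  by apply: contra_notN NI0 => /eqP; exists k.
have [[k wk Ik]|NIy] := pselect (exists2 k, (0 < w k)%R & I k = +oo).
  by rewrite [leRHS](@prode_eqy _ _ _ k) ?leey// -/(I k) Ik poweRyr// gt_eqF.
(* At weight [0] the integral may be [0] or [+oo]; the value [1] keeps [r k] a legitimate
   divisor. *)
pose r k := if (0 < w k)%R then fine (I k) else 1%R.
have rE k : (0 < w k)%R -> I k = (r k)%:E.
  move=> wk; rewrite /r wk fineK// ge0_fin_numE// ltey.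
  by apply: contra_notN NIy => /eqP; exists k.
have r0 k : (0 < r k)%R.
  have [wk|wk] := boolP (0 < w k)%R; last by rewrite /r (negbTE wk).
  rewrite -lte_fin -rE// lt_def I0 andbT.
  by apply: contra_notN NI0 => /eqP; exists k.
have rI k : I k `^ w k = (r k)%:E `^ w k.
  have := w0 k; rewrite le_eqVlt => /predU1P[<-|wk]; first by rewrite !poweRe0.
  by rewrite rE.
under [leRHS]eq_bigr do rewrite rI.
set c := \prod_k _.
have c0 : 0 <= c by apply: prode_ge0 => k _; exact: poweR_ge0.
pose G x := \sum_k (w k / r k)%:E * F k x.
have wr0 k : (0 <= w k / r k)%R by rewrite divr_ge0// ltW.
have mG : measurable_fun setT G.
  by apply: emeasurable_sum => k; exact: measurable_funeM.
have G0 x : 0 <= G x by apply: sume_ge0 => k _; rewrite mule_ge0 ?lee_fin.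
apply: (@le_trans _ _ (\int[mu]_x (c * G x))).
  apply: ge0_le_integral => //.
    exact: measurable_funeM.
  move=> x _.
  have -> : \prod_k F k x `^ w k = c * \prod_k ((r k)^-1%:E * F k x) `^ w k.
    rewrite /c -big_split; apply: eq_bigr => k _.
    have {1}-> : F k x = (r k)%:E * ((r k)^-1%:E * F k x).
      by rewrite muleA -EFinM divff ?gt_eqF// mul1e.
    by rewrite poweRM ?mule_ge0 ?lee_fin ?invr_ge0 ?(ltW (r0 k)).
  apply: lee_wpmul2l => //; apply: le_trans (amgm_poweR w0 w1 _) _.
    by move=> k; rewrite mule_ge0// lee_fin invr_ge0 ltW.
  by apply: lee_sum => k _; rewrite muleA -EFinM.
rewrite ge0_integralZl// ge0_integral_sum//; last 2 first.
- by move=> k; exact: measurable_funeM.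
- by move=> k x _; rewrite mule_ge0 ?lee_fin.
have -> : \sum_k \int[mu]_x ((w k / r k)%:E * F k x) = 1; last by rewrite mule1.
rewrite -[RHS]/(1%:E) -w1 -sumEFin; apply: eq_bigr => k _.
rewrite ge0_integralZl_EFin//.
have := w0 k; rewrite le_eqVlt => /predU1P[<-|wk]; first by rewrite mul0r mul0e.
by rewrite -/(I k) rE// -EFinM divfK// gt_eqF.
Qed.

(** * Integration one coordinate at a time *)

Section marginals.
Context (R : realType) (I : finType) (d : I -> measure_display).
Context (X : forall i, measurableType (d i)).
Implicit Types (x : product_space X) (i j : I) (s : seq I).

Definition update x j (t : X j) : product_space X :=
  eqtype.dfwith (x : forall i, X i) t.

Lemma update_in x j (t : X j) : update x t j = t.
Proof. exact: dfwith_in. Qed.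

Lemma update_out x j (t : X j) i : i != j -> update x t i = x i.
Proof. by rewrite eq_sym; exact: dfwith_out. Qed.

Lemma updateC x i j (t : X i) (u : X j) : i != j ->
  update (update x t) u = update (update x u) t.
Proof.
move=> ij; apply/functional_extensionality_dep => l.
have [->|lj] := eqVneq l j.
  by rewrite update_in update_out 1?eq_sym// update_in.
rewrite update_out//; have [->|li] := eqVneq l i; first by rewrite !update_in.
by rewrite !update_out.
Qed.

Lemma measurable_update j :
  measurable_fun setT (fun xt : product_space X * X j => update xt.1 xt.2).
Proof.
apply: measurable_fun_product => i; have [->|ij] := eqVneq i j.
  by under eq_fun do rewrite update_in; exact: measurable_snd.
under eq_fun do rewrite update_out//.
exact: (measurableT_comp (@measurable_coord _ _ X i) measurable_fst).
Qed.

Variable mu : forall i, {sigma_finite_measure set (X i) -> \bar R}.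
Implicit Types F G : product_space X -> \bar R.

(** The result remains a function on the whole product, constant in coordinate [j], so that
    iterating over coordinates never changes the type. *)
Definition marginal j F x := \int[mu j]_t F (update x t).

Fixpoint marginals s F :=
  if s is j :: s' then marginals s' (marginal j F) else F.

Lemma marginals_cat s1 s2 F :
  marginals (s1 ++ s2) F = marginals s2 (marginals s1 F).
Proof. by elim: s1 F => //= j s1 IH F. Qed.

Lemma measurable_update_r F x j : measurable_fun setT F ->
  measurable_fun setT (fun t : X j => F (update x t)).
Proof.
move=> mF; apply: (measurableT_comp mF).
apply: measurable_fun_product => i; have [->|ij] := eqVneq i j.
  by under eq_fun do rewrite update_in; exact: measurable_id.
by under eq_fun do rewrite update_out//; exact: measurable_cst.
Qed.

Lemma marginal_ge0 j F : (forall x, 0 <= F x) -> forall x, 0 <= marginal j F x.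
Proof. by move=> F0 x; apply: integral_ge0. Qed.

Lemma measurable_marginal j F :
  measurable_fun setT F -> (forall x, 0 <= F x) ->
  measurable_fun setT (marginal j F).
Proof.
move=> mF F0.
apply: (@measurable_fun_fubini_tonelli_F _ _ _ _ _ (mu j)
  (fun xt => F (update xt.1 xt.2))) => //.
by apply: (measurableT_comp mF); exact: measurable_update.
Qed.

Lemma le_marginals s F G :
  measurable_fun setT F -> measurable_fun setT G ->
  (forall x, 0 <= F x <= G x) -> forall x, marginals s F x <= marginals s G x.
Proof.
elim: s F G => [F G mF mG FG x|j s IH F G mF mG FG x] /=.
  by have /andP[] := FG x.
have F0 y : 0 <= F y by have /andP[] := FG y.
have G0 y : 0 <= G y by have /andP[/le_trans +] := FG y; exact.
apply: IH => [||y]; [exact: measurable_marginal..|].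
rewrite marginal_ge0//=; apply: ge0_le_integral => //.
- exact: measurable_update_r.
- exact: measurable_update_r.
- by move=> t _; have /andP[] := FG (update y t).
Qed.

Lemma indic_box (A : forall i, set (X i)) x :
  (\1_(box A) x)%:E = \prod_i (\1_(A i) (x i))%:E :> \bar R.
Proof.
have [xA|/existsNP[i xiA]] := pselect (box A x).
  by rewrite indicE mem_set// big1// => i _; rewrite indicE mem_set.
by rewrite (@prode_eq0 _ _ _ i) ?indicE ?memNset.
Qed.

(* The product of the [mu j], [j] in [s], and of Dirac masses at the other
   coordinates of [x]. *)
Lemma iterated_measure_exists s (x : product_space X) : uniq s ->
  exists m : {measure set (product_space X) -> \bar R},
    (forall A, (forall i, measurable (A i)) ->
      m (box A) =
        \prod_i (if i \in s then mu i (A i) else (\1_(A i) (x i))%:E)) /\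
    (forall F, measurable_fun setT F -> (forall x, 0 <= F x) ->
      \int[m]_y F y = marginals s F x).
Proof.
elim: s => [_|j s IH /= /andP[js us]].
  exists (dirac x); split => [A mA|F mF F0].
    by rewrite /= diracE -indic_box indicE.
  by rewrite integral_dirac//= diracT mul1e.
have [m1 [m1box m1int]] := IH us.
have sfm1 : sigma_finite setT m1.
  have [B [mB Boo Bcov]] := box_exhaustion mu.
  exists (fun k => box (B k)); first by rewrite Bcov.
  move=> k; split; first exact: measurable_box.
  rewrite m1box// ltey_eq prode_fin_num// => i _; case: ifPn => _ //.
  by rewrite ge0_fin_numE.
have [m m1E] := sigma_finite_packed sfm1.
(* The measure for [j :: s] is the image of [m \x mu j] under overwriting coordinate [j]. The
   preimage of a box has its side [j] relaxed to the full space, where the Dirac mass left by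
   [j \notin s] contributes a factor [1]. *)
pose upd (xt : product_space X * X j) := update xt.1 xt.2.
have mupd : measurable_fun setT upd by exact: measurable_update.
exists (measure_function_pushforward__canonical__measure_function_Measure
  (m \x mu j)%E mupd); split => [A mA|F mF F0]; last first.
  rewrite /= ge0_integral_pushforward//= preimage_setT.
  rewrite fubini_tonelli1//=; last exact: (measurableT_comp mF).
  rewrite -m1int; [|exact: measurable_marginal|exact: marginal_ge0].
  by apply: eq_measure_integral => B mB _; exact: m1E.
pose A' : forall i, set (X i) := eqtype.dfwith A [set: X j].
have A'j : A' j = setT by exact: dfwith_in.
have A'E i : i != j -> A' i = A i by rewrite eq_sym; exact: dfwith_out.
have mA' i : measurable (A' i).
  by have [->|/A'E ->//] := eqVneq i j; rewrite A'j.
rewrite /= /pushforward.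
have -> : upd @^-1` box A = box A' `*` A j.
  apply/seteqP; split => [[y t] Ayt|[y t] [/= A'y At] i].
    split => [i|] /=; last by have := Ayt j; rewrite /upd update_in.
    have [->|ij] := eqVneq i j; first by rewrite A'j.
    by rewrite A'E//; have := Ayt i; rewrite /upd update_out.
  rewrite /upd; have [->|ij] := eqVneq i j; first by rewrite update_in.
  by rewrite update_out// -A'E.
rewrite product_measure1E//; last exact: measurable_box.
transitivity (m1 (box A') * mu j (A j)).
  by congr (_ * _); exact: m1E.
rewrite m1box// [in LHS](bigD1 j)//= [in RHS](bigD1 j)//=.
rewrite (negbTE js) mem_head A'j indicE mem_set// mul1e muleC; congr (_ * _).
by apply: eq_bigr => i ij; rewrite in_cons (negbTE ij)/= A'E.
Qed.

(** When [s] lists all coordinates no Dirac mass remains, so the iterated measure agrees with the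
    product measure on boxes, hence everywhere. The base point [x] is arbitrary, and so is the order
    of integration. *)
Lemma integral_product_measure s F x : uniq s -> (forall i, i \in s) ->
  measurable_fun setT F -> (forall x, 0 <= F x) ->
  \int[product_measure mu]_y F y = marginals s F x.
Proof.
move=> us sT mF F0; have [m [mbox mint]] := iterated_measure_exists x us.
rewrite -mint//; apply: eq_measure_integral => A mA _.
apply: (product_measure_uniq (mu := mu)) => // B mB.
  exact: product_measureE.
by rewrite mbox//; apply: eq_bigr => i _; rewrite sT.
Qed.

End marginals.

(** * Finner's inequality *)

Section finner.
Context (R : realType) (I : finType) (d : I -> measure_display).
Context (X : forall i, measurableType (d i)).
Variable mu : forall i, {sigma_finite_measure set (X i) -> \bar R}.
Context (K : finType) (A : K -> {set I}) (w : K -> R).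
Hypothesis w0 : forall k, (0 <= w k)%R.
Implicit Types (x : product_space X) (F : K -> product_space X -> \bar R).

Let ignores F := forall k x j (t : X j), j \notin A k ->
  F k (update x t) = F k x.

Let measurable_prod_poweR F : (forall k, measurable_fun setT (F k)) ->
  measurable_fun setT (fun x => \prod_k F k x `^ w k).
Proof.
by move=> mF; apply: emeasurable_prod => k; exact: emeasurable_poweR.
Qed.

Let prod_poweR_ge0 F x : 0 <= \prod_k F k x `^ w k.
Proof. by apply: prode_ge0 => k _; exact: poweR_ge0. Qed.

(** In the variable [j] the factors with [j \notin A k] are constant and leave the integral; the
    weights of the others add up to [1], so Hölder's inequality applies to them. *)
Lemma finner_step F j x : (\sum_(k | j \in A k) w k = 1)%R ->
  (forall k, measurable_fun setT (F k)) -> (forall k x, 0 <= F k x) ->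
  ignores F ->
  marginal mu j (fun x => \prod_k F k x `^ w k) x <=
  \prod_k (if j \in A k then marginal mu j (F k) x else F k x) `^ w k.
Proof.
move=> w1 mF F0 igF; rewrite /marginal.
(* Extending the weights by [0] lets Hölder's inequality run over all of [K]. *)
pose v k := if j \in A k then w k else 0%R.
pose c := \prod_(k | j \notin A k) F k x `^ w k.
have c0 : 0 <= c by apply: prode_ge0 => k _; exact: poweR_ge0.
have splitw (G : K -> \bar R) :
    \prod_(k | j \in A k) G k `^ w k = \prod_k G k `^ v k.
  rewrite big_mkcond; apply: eq_bigr => k _; rewrite /v.
  by case: ifP => // _; rewrite poweRe0.
have mFx k : measurable_fun setT (fun t : X j => F k (update x t)).
  exact: measurable_update_r.
have -> : (fun t : X j => \prod_k F k (update x t) `^ w k) =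
    (fun t => c * \prod_k F k (update x t) `^ v k).
  apply/funext => t; rewrite (bigID (fun k => j \in A k))/= muleC splitw.
  by congr (_ * _); apply: eq_bigr => k jk; rewrite igF.
rewrite ge0_integralZl//; last 2 first.
- by apply: emeasurable_prod => k; exact: emeasurable_poweR.
- by move=> t _; apply: prode_ge0 => k _; exact: poweR_ge0.
rewrite [leRHS](bigID (fun k => j \in A k))/= [leRHS]muleC.
have -> : \prod_(k | j \notin A k)
    (if j \in A k then \int[mu j]_t F k (update x t) else F k x) `^ w k = c.
  by apply: eq_bigr => k /negbTE ->.
have -> : \prod_(k | j \in A k)
    (if j \in A k then \int[mu j]_t F k (update x t) else F k x) `^ w k =
    \prod_k (\int[mu j]_t F k (update x t)) `^ v k.
  by rewrite -splitw; apply: eq_bigr => k ->.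
apply: lee_wpmul2l => //; apply: hoelder_prod => //.
- by move=> k; rewrite /v; case: ifP.
- by rewrite -w1 [RHS]big_mkcond.
Qed.

(** Induction on [s] with [F] varying: one step replaces [F k] by its marginal whenever [j \in A k].
    The new family still ignores the coordinates outside [A k], since updates at distinct
    coordinates commute. *)
Lemma finner_marginals F s x :
  (forall j, j \in s -> \sum_(k | j \in A k) w k = 1)%R ->
  (forall k, measurable_fun setT (F k)) -> (forall k x, 0 <= F k x) ->
  ignores F ->
  marginals mu s (fun x => \prod_k F k x `^ w k) x <=
  \prod_k (marginals mu [seq j <- s | j \in A k] (F k) x) `^ w k.
Proof.
elim: s F => [F _ _ _ _|j s IH F w1 mF F0 igF] /=; first exact: lexx.
pose F' k := if j \in A k then marginal mu j (F k) else F k.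
have mF' k : measurable_fun setT (F' k).
  by rewrite /F'; case: ifP => // _; exact: measurable_marginal.
have F'0 k y : 0 <= F' k y.
  by rewrite /F'; case: ifP => // _; exact: marginal_ge0.
have igF' : ignores F'.
  move=> k y i t iA; rewrite /F'; case: ifP => [jA|_]; last exact: igF.
  apply: eq_integral => u _; rewrite updateC; first exact: igF.
  by apply: contraNneq iA => ->.
apply: (@le_trans _ _ (marginals mu s (fun y => \prod_k F' k y `^ w k) x)).
  apply: le_marginals => [||y].
  - by apply: measurable_marginal => //; exact: measurable_prod_poweR.
  - exact: measurable_prod_poweR.
  rewrite marginal_ge0//=.
  have := finner_step y (w1 j (mem_head _ _)) mF F0 igF.
  move=> /le_trans; apply; rewrite le_eqVlt; apply/orP; left; apply/eqP.
  by apply: eq_bigr => k _; rewrite /F'; case: ifP.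
apply: le_trans (IH F' _ mF' F'0 igF') _.
  by move=> i si; apply: w1; rewrite in_cons si orbT.
rewrite le_eqVlt; apply/orP; left; apply/eqP.
by apply: eq_bigr => k _; rewrite /F'; case: ifP.
Qed.

End finner.

(** * Splitting a product along a set of coordinates *)

Definition restr (I : finType) (d : I -> measure_display)
    (X : forall i, measurableType (d i)) (E : {set I}) (x : product_space X) :
    subproduct X E :=
  fun j => x (val j).
Arguments restr {I d X} E x.

Section subproducts.
Local Notation glue := Defs.glue.
Context (R : realType) (I : finType) (d : I -> measure_display).
Context (X : forall i, measurableType (d i)).
Implicit Types (x : product_space X) (E : {set I}).

Lemma restr_update E x (j : {j | j \in E}) (t : X (val j)) :
  restr E (update x t) =
  update (X := fun j : {j | j \in E} => X (val j)) (restr E x) t.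
Proof.
apply/functional_extensionality_dep => i; rewrite /restr.
have [->|ij] := eqVneq i j; first by rewrite !update_in.
by rewrite !update_out.
Qed.

Lemma restr_update_out E x j (t : X j) : j \notin E ->
  restr E (update x t) = restr E x.
Proof.
move=> jE; apply/functional_extensionality_dep => i; rewrite /restr.
by rewrite update_out//; apply: contraNneq jE => <-; exact: valP.
Qed.

(** The [match] in [glue] returns proofs of membership, so it cannot be destructed in place; the
    proof first generalises over [boolP (j \in E)] and its boolean. *)
Lemma glueE E (y : subproduct X E) (z : subproduct X (~: E)) j
    (P : X j -> Prop) :
  (forall jE : j \in E, P (y (Sub j jE))) ->
  (forall jE : j \in ~: E, P (z (Sub j jE))) -> P (glue y z j).
Proof.
move=> Py Pz.
suff alt b (a : alt_spec (is_true (j \in E)) (j \in E) b) :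
    P (match a with
       | AltTrue jE => y (Sub j jE)
       | AltFalse jE => z (Sub j (introT setCP (elimN idP jE)))
       end) by exact: alt.
by case: a.
Qed.

Lemma glue_restr E x : glue (restr E x) (restr (~: E) x) = x.
Proof.
apply/functional_extensionality_dep => j.
exact: (glueE (P := fun v => v = x j)).
Qed.

Lemma restr_glue E (y : subproduct X E) (z : subproduct X (~: E)) :
  restr E (glue y z) = y.
Proof.
apply/functional_extensionality_dep => -[j jE]; rewrite /restr.
apply: (glueE (P := fun v => v = y _)) => jE' /=.
  by rewrite (bool_irrelevance jE' jE).
by have := jE'; rewrite inE jE.
Qed.

Lemma restrC_glue E (y : subproduct X E) (z : subproduct X (~: E)) :
  restr (~: E) (glue y z) = z.
Proof.
apply/functional_extensionality_dep => -[j jE]; rewrite /restr.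
apply: (glueE (P := fun v => v = z _)) => jE' /=; last first.
  by rewrite (bool_irrelevance jE' jE).
by have := jE; rewrite inE jE'.
Qed.

Lemma glue_update E (y : subproduct X E) (z : subproduct X (~: E))
    (j : {j | j \in ~: E}) (t : X (val j)) :
  glue y (update (X := fun j : {j | j \in ~: E} => X (val j)) z t) =
  update (glue y z) t.
Proof.
(* A point is determined by its two restrictions, so it suffices to compare these. *)
apply: (can_inj (f := fun x => (restr E x, restr (~: E) x))
  (g := fun yz => glue yz.1 yz.2)) => [x|]; first exact: glue_restr.
rewrite restr_update !restrC_glue restr_update_out ?restr_glue//.
by have := valP j; rewrite inE.
Qed.

Lemma measurable_restr E : measurable_fun setT (@restr _ _ X E).
Proof. by apply: measurable_fun_product => j; exact: measurable_coord. Qed.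

Lemma measurable_glue E :
  measurable_fun setT
    (fun yz : subproduct X E * subproduct X (~: E) => glue yz.1 yz.2).
Proof.
have mE (i : {i | i \in E}) : measurable_fun setT
    (fun yz : subproduct X E * subproduct X (~: E) => glue yz.1 yz.2 (val i)).
  have -> : (fun yz : subproduct X E * subproduct X (~: E) =>
      glue yz.1 yz.2 (val i)) = fun yz => yz.1 i.
    apply/funext => yz.
    exact: (f_equal (fun y : subproduct X E => y i) (restr_glue yz.1 yz.2)).
  exact: (measurableT_comp (@measurable_coord _ _ (fun i => X (val i)) i)
    (@measurable_fst _ _ (subproduct X E) (subproduct X (~: E)))).
have mEC (i : {i | i \in ~: E}) : measurable_fun setT
    (fun yz : subproduct X E * subproduct X (~: E) => glue yz.1 yz.2 (val i)).
  have -> : (fun yz : subproduct X E * subproduct X (~: E) =>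
      glue yz.1 yz.2 (val i)) = fun yz => yz.2 i.
    apply/funext => yz.
    exact: (f_equal (fun z : subproduct X (~: E) => z i)
      (restrC_glue yz.1 yz.2)).
  exact: (measurableT_comp (@measurable_coord _ _ (fun i => X (val i)) i)
    (@measurable_snd _ _ (subproduct X E) (subproduct X (~: E)))).
apply: measurable_fun_product => j.
have [jE|jE] := boolP (j \in E); first exact: (mE (Sub j jE)).
by have jE' : j \in ~: E by [rewrite inE]; exact: (mEC (Sub j jE')).
Qed.

Variable mu : forall i, {sigma_finite_measure set (X i) -> \bar R}.

Let muE E (j : {j | j \in E}) := mu (val j).

Lemma marginals_restr E s (G : subproduct X E -> \bar R) x :
  marginals mu (map val s) (G \o restr E) x =
  marginals (@muE E) s G (restr E x).
Proof.
elim: s G => //= j s IH G; rewrite -IH; congr marginals.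
by apply/funext => y; apply: eq_integral => t _ /=; rewrite restr_update.
Qed.

Lemma marginals_glue E s (F : product_space X -> \bar R) y z :
  marginals (@muE (~: E)) s (F \o @glue _ _ X E y) z =
  marginals mu (map val s) F (glue y z).
Proof.
elim: s F => //= j s IH F; rewrite -IH; congr marginals.
by apply/funext => u; apply: eq_integral => t _ /=; rewrite glue_update.
Qed.

Let sub_seq E (s : seq I) : seq {j | j \in E} := pmap insub s.

Let map_sub_seq E s : map val (sub_seq E s) = [seq j <- s | j \in E].
Proof.
rewrite (pmap_filter (insubK _)); apply: eq_filter => j.
exact: isSome_insub.
Qed.

Let sub_seq_full E s : (forall j, j \in s) -> forall j, j \in sub_seq E s.
Proof. by move=> sT j; rewrite mem_pmap_sub. Qed.

(** Brings integrals over a subproduct back to marginals on the whole product, the form in which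
    Finner's inequality is proved. *)
Lemma integral_subproduct E s (G : subproduct X E -> \bar R) x :
  uniq s -> (forall j, j \in s) ->
  measurable_fun setT G -> (forall y, 0 <= G y) ->
  \int[subproduct_measure mu E]_y G y =
  marginals mu [seq j <- s | j \in E] (G \o restr E) x.
Proof.
move=> us sT mG G0; rewrite -map_sub_seq marginals_restr.
apply: integral_product_measure => //; first exact: pmap_sub_uniq.
exact: sub_seq_full.
Qed.

Lemma integral_glue E (F : product_space X -> \bar R) :
  measurable_fun setT F -> (forall x, 0 <= F x) ->
  \int[product_measure mu]_x F x =
  \int[subproduct_measure mu E]_y \int[subproduct_measure mu (~: E)]_z
    F (glue y z).
Proof.
move=> mF F0.
have [e ue eT] : exists2 e : seq I, uniq e & forall j, j \in e.
  by exists (enum I); [exact: enum_uniq|move=> j; rewrite mem_enum].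
pose s (A : {set I}) := [seq j <- e | j \in A].
have us A : uniq (s A) by exact: filter_uniq.
have mFg y : measurable_fun setT (F \o @glue _ _ X E y).
  apply: (measurableT_comp mF).
  exact: (measurableT_comp (@measurable_glue E) (pair1_measurable y)).
(* The coordinates outside [E] are listed first, so that they form the inner integral. *)
rewrite (@integral_product_measure _ _ _ _ _ (s (~: E) ++ s E) _ point)//.
- rewrite marginals_cat (@integral_subproduct _ e _ point ue eT).
  + congr (marginals _ _ _ point); apply/funext => x /=.
    rewrite -{1}(glue_restr E x) /s -map_sub_seq -marginals_glue.
    apply/esym/integral_product_measure => //; first exact: pmap_sub_uniq.
      exact: sub_seq_full.
    exact: mFg.
  + apply: (@measurable_fun_fubini_tonelli_F _ _ _ _ _
      (subproduct_measure mu (~: E)) (fun yz => F (glue yz.1 yz.2))) => //.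
    by apply: (measurableT_comp mF); exact: measurable_glue.
  + by move=> y; exact: integral_ge0.
- rewrite cat_uniq !us andbT /=.
  apply/hasPn => j; rewrite !mem_filter => /andP[jE _].
  by rewrite inE jE.
- by move=> j; rewrite mem_cat !mem_filter finset.in_setC -andb_orl orNb eT.
Qed.

(** Identifies the product with a pair of spaces, so that mixed norms can be studied for two
    abstract factors. *)
Lemma integral_restr_pair E
    (U : subproduct X E * subproduct X (~: E) -> \bar R) :
  measurable_fun setT U -> (forall yz, 0 <= U yz) ->
  \int[product_measure mu]_x U (restr E x, restr (~: E) x) =
  \int[subproduct_measure mu E \x subproduct_measure mu (~: E)]_yz U yz.
Proof.
move=> mU U0; rewrite (integral_glue E)//.
  rewrite [RHS](fubini_tonelli1 _ mU U0).
  apply: eq_integral => y _; apply: eq_integral => z _.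
  by rewrite restr_glue restrC_glue.
apply: (measurableT_comp mU).
by apply: measurable_fun_pair; exact: measurable_restr.
Qed.

End subproducts.

(** * Mixed norms *)

Lemma ae_le_Lnormy (R : realType) (d : measure_display) (T : measurableType d)
    (mu : {measure set T -> \bar R}) (f : T -> \bar R) :
  {ae mu, forall x, f x <= Lnorm mu +oo f}.
Proof.
rewrite unlock; case: ifPn => [_|].
  apply: filterS (ess_sup_ge mu (abse \o f)) => x; apply: le_trans.
  exact: lee_abs.
(* On a space of measure zero the norm is [0], but then every property holds almost everywhere. *)
rewrite lt0e measure_ge0 andbT negbK => /eqP mu0.
by exists setT; split.
Qed.

(** Equality holds at finite [x]; at [+oo] with [r != 0] both powers are [+oo], which is why only an
    inequality is claimed. *)
Lemma poweR_cancel (R : realType) (x : \bar R) (r : R) :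
  0 < x -> 1 <= x `^ r * x `^ (- r).
Proof.
move=> x0; have [->|r0] := eqVneq r 0%R.
  by rewrite oppr0 poweRe0 mule1.
case: x x0 => // [x x0|_]; last first.
  by rewrite !poweRyr ?oppr_eq0// mulyy leey.
rewrite -poweRD ?subrr ?poweRe0// /poweRD_def subrr eqxx/=.
by rewrite gt_eqF.
Qed.

Section mixed_norm_pair.
Context (R : realType) (d1 d2 : measure_display).
Context (T1 : measurableType d1) (T2 : measurableType d2).
Variables (m1 : {sigma_finite_measure set T1 -> \bar R}).
Variables (m2 : {sigma_finite_measure set T2 -> \bar R}).

(** Almost every section of the complement of [P] is null, so its product measure is the integral of
    a function that is [0] almost everywhere. *)
Lemma ae_product (P : set (T1 * T2)) : measurable P ->
  {ae m1, forall y, {ae m2, forall z, P (y, z)}} ->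
  {ae m1 \x m2, forall yz, P yz}.
Proof.
move=> mP aeP; exists (~` P); split => //; first exact: measurableC.
rewrite /= /product_measure1; transitivity (\int[m1]_y (cst 0 y : \bar R)).
  apply: ge0_ae_eq_integral => //.
    by apply: measurable_fun_xsection; exact: measurableC.
  apply: filterS aeP => y [N [mN N0 PN]] _ /=.
  apply: (subset_measure0 _ mN _ N0).
    by apply: measurable_xsection; exact: measurableC.
  by move=> z /xsectionP; exact: PN.
by rewrite integral0.
Qed.

Variable F : T1 * T2 -> \bar R.
Hypothesis mF : measurable_fun setT F.
Hypothesis F0 : forall yz, 0 <= F yz.

Let mF2 y : measurable_fun setT (fun z => F (y, z)).
Proof. exact: (measurableT_comp mF (pair1_measurable y)). Qed.

Let g (q : \bar R) y := Lnorm m2 q (fun z => F (y, z)).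

Let normF y : abse \o (fun z => F (y, z)) = (fun z => F (y, z)).
Proof. by apply/funext => z /=; rewrite gee0_abs. Qed.

(** The essential supremum at [y] exceeds [r] exactly when the section at [y] of the set where [F]
    exceeds [r] has positive measure, and the measure of a section is measurable in [y]. *)
Let measurable_ess_sup :
  measurable_fun setT (fun y => ess_sup m2 (fun z => F (y, z))).
Proof.
apply: (measurability _ (ErealGenOInfty.measurableE R)) => // _ [_ [r ->] <-].
rewrite setTI; pose N := [set yz | r%:E < F yz].
have mN : measurable N.
  rewrite -[N]setTI; exact: emeasurable_fun_o_infty.
rewrite [X in measurable X](_ : _ = [set y | 0 < m2 (xsection N y)]).
  rewrite -[X in measurable X]setTI.
  by apply: emeasurable_fun_o_infty => //; exact: measurable_fun_xsection.
have NE y : xsection N y = (fun z => F (y, z)) @^-1` `]r%:E, +oo[.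
  apply/seteqP; split => [z /xsectionP Nz|z Fz].
    by rewrite /= in_itv/= andbT.
  by apply/xsectionP; move: Fz; rewrite /= in_itv/= andbT.
apply/seteqP; split => y /=; rewrite in_itv/= andbT !ltNge; apply: contra.
- move=> Ny; apply/ess_supP/ae_le_measureP => //.
  by apply/eqP; rewrite eq_le measure_ge0 -NE Ny.
- by move=> /ess_supP/(ae_le_measureP _ _ (mF2 y)).1; rewrite NE => ->.
Qed.

Lemma measurable_Lnorm_section (q : \bar R) : 0 < q ->
  measurable_fun setT (g q).
Proof.
rewrite /g; case: q => [q q0|_|//]; last first.
  have [m20|/negbTE m20] := boolP (0 < m2 setT).
    by under eq_fun do rewrite unlock m20 normF.
  by under eq_fun do rewrite unlock m20; exact: measurable_cst.
under eq_fun do rewrite unlock; apply: emeasurable_poweR.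
apply: (@measurable_fun_fubini_tonelli_F _ _ _ _ _ m2 (fun yz => `|F yz| `^ q)).
  by apply: emeasurable_poweR; exact: measurableT_comp.
by move=> yz; exact: poweR_ge0.
Qed.

Let Lnorm_poweR (q : R) y : (0 < q)%R ->
  \int[m2]_z (F (y, z) `^ q) = g q%:E y `^ q.
Proof.
move=> q0; rewrite /g poweR_Lnorm ?gt_eqF//.
by apply: eq_integral => z _; rewrite gee0_abs.
Qed.

(* The constant [C] only serves when [p] and [q] are both infinite: then
   [a = b = 0] and the bound carries no other information.  The conventions
   [x `^ 0 = 1] and [+oo `^ r = +oo] for all [r != 0] (also negative) spare a
   separate treatment of the points where the inner norm is infinite. *)
Lemma mixed_norm_majorant (q p : \bar R) (a b : R) :
  (0 <= a)%R -> (0 <= b)%R -> q^-1 = a%:E -> p^-1 = (a + b)%:E ->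
  exists (C : \bar R) (u : T1 * T2 -> \bar R) (w : T1 -> \bar R),
  [/\ 0 <= C,
      measurable_fun setT u /\ (forall yz, 0 <= u yz),
      measurable_fun setT w /\ (forall y, 0 <= w y),
      {ae m1 \x m2, forall yz, F yz <= C * (u yz `^ a * w yz.1 `^ b)} &
      C * ((\int[m1 \x m2]_yz u yz) `^ a * (\int[m1]_y w y) `^ b) <=
        Lnorm m1 p (g q)].
Proof.
move=> a0 b0 qa pab; have g0 r y : 0 <= g r y by exact: Lnorm_ge0.
have mle (G : T1 * T2 -> \bar R) : measurable_fun setT G ->
    measurable [set yz | F yz <= G yz].
  by move=> mG; rewrite -[X in measurable X]setTI; exact: measurable_lee.
have LnormE (s : R) : Lnorm m1 s%:E (g q) = (\int[m1]_y (g q y `^ s)) `^ s^-1.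
  by rewrite unlock; under eq_integral do rewrite gee0_abs//.
move: a0; rewrite le_eqVlt => /predU1P[a0|a0]; last first.
  (* Case of finite [q]: [r] and [s] are the real values of [q] and [p]. *)
  pose r := a^-1%R; pose s := (a + b)^-1%R.
  have ab0 : (0 < a + b)%R by rewrite ltr_wpDr.
  have r0 : (0 < r)%R by rewrite invr_gt0.
  have s0 : (0 < s)%R by rewrite invr_gt0.
  have qE : q = r%:E by rewrite -(inveK q) qa inver gt_eqF.
  have pE : p = s%:E by rewrite -(inveK p) pab inver gt_eqF.
  have mg : measurable_fun setT (g q).
    by apply: measurable_Lnorm_section; rewrite qE.
  have mg1 : measurable_fun setT (fun yz : T1 * T2 => g q yz.1).
    exact: (measurableT_comp mg measurable_fst).
  pose u yz := F yz `^ r * g q yz.1 `^ (s - r).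
  have mu : measurable_fun setT u.
    by apply: emeasurable_funM; exact: emeasurable_poweR.
  have u0 yz : 0 <= u yz by rewrite mule_ge0 ?poweR_ge0.
  have mw : measurable_fun setT (fun y => g q y `^ s).
    exact: emeasurable_poweR.
  exists 1, u, (fun y => g q y `^ s); split => //.
  - by split => // y; exact: poweR_ge0.
  - apply: ae_product.
      apply: mle; apply: measurable_funeM; apply: emeasurable_funM.
        exact: (emeasurable_poweR a mu).
      exact: (emeasurable_poweR b (emeasurable_poweR s mg1)).
    (* If the inner norm vanishes at [y], so does [F] almost everywhere on that section; otherwise
       the powers of the inner norm cancel. *)
    apply: aeW => y; have [gy0|gy0] := eqVneq (g q y) 0.
      have q0 : 0 < q by rewrite qE lte_fin.
      apply: filterS (Lnorm_eq0_eq0 (mF2 y) q0 gy0) => z /= /(_ I) ->.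
      by rewrite mul1e mule_ge0 ?poweR_ge0.
    apply: aeW => z /=; rewrite mul1e /u /= poweRM ?poweR_ge0// -!poweRrM.
    (* Both [s * (a + b)] and [r * a] equal [1], so the powers of the inner norm coming from [u] and
       from [w] have opposite exponents. *)
    have -> : (s * b = - ((s - r) * a))%R.
      rewrite mulrBl opprB [(r * a)%R]mulVf ?gt_eqF//.
      by rewrite -(mulVf (lt0r_neq0 ab0)) -/s mulrDr addrC addKr.
    rewrite mulVf ?gt_eqF// poweRe1// -muleA -[leLHS]mule1.
    by apply: lee_wpmul2l => //; apply: poweR_cancel; rewrite lt_def gy0 g0.
  (* Integrating in [z] first turns the power [r] of [F] into the power [r] of the inner norm. Thus
     [u] and [w] have the same integral, and its powers [a] and [b] multiply to the power
     [a + b = s^-1], which is the outer norm. *)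
  - have -> : \int[m1 \x m2]_yz u yz = \int[m1]_y (g q y `^ s).
      rewrite fubini_tonelli1//; apply: eq_integral => y _.
      rewrite /fubini_F /u /=.
      under eq_integral do rewrite muleC.
      rewrite ge0_integralZl ?poweR_ge0//; last 2 first.
      + exact: emeasurable_poweR.
      + by move=> z _; exact: poweR_ge0.
      rewrite Lnorm_poweR// -qE -poweRD ?subrK//.
      by apply: add_neq0_poweRD_def; rewrite subrK gt_eqF.
    rewrite mul1e pE LnormE -poweRD ?invrK//.
    by apply: add_neq0_poweRD_def; rewrite gt_eqF.
(* Case [a = 0]: any function to the power [0] is [1], so [u] is taken to be [0], and [F] is bounded
   by the inner norm almost everywhere on each section. *)
have qE : q = +oo by rewrite -(inveK q) qa -a0 inver eqxx.
have mg : measurable_fun setT (g q).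
  by apply: measurable_Lnorm_section; rewrite qE.
have mg1 : measurable_fun setT (fun yz : T1 * T2 => g q yz.1).
  exact: (measurableT_comp mg measurable_fst).
have Fg y : {ae m2, forall z, F (y, z) <= g q y}.
  by rewrite /g qE; exact: ae_le_Lnormy.
move: b0; rewrite le_eqVlt => /predU1P[b0|b0].
  have pE : p = +oo by rewrite -(inveK p) pab -a0 -b0 addr0 inver eqxx.
  exists (Lnorm m1 p (g q)), (cst 0), (cst 0); rewrite -a0 -b0.
  split => //; first exact: Lnorm_ge0.
    rewrite pE; apply: ae_product.
      by apply: mle; rewrite /cst; exact: measurable_cst.
    apply: filterS (ae_le_Lnormy m1 (g q)) => y gy.
    apply: filterS (Fg y) => z Fyz.
    by rewrite !poweRe0 !mule1; exact: le_trans Fyz gy.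
  by rewrite !poweRe0 !mule1.
pose s := b^-1%R.
have pE : p = s%:E by rewrite -(inveK p) pab -a0 add0r inver gt_eqF.
have mw : measurable_fun setT (fun y => g q y `^ s) by exact: emeasurable_poweR.
exists 1, (cst 0), (fun y => g q y `^ s); rewrite -a0; split => //.
- by split => // y; exact: poweR_ge0.
- apply: ae_product.
    apply: mle; do 2 apply: measurable_funeM.
    exact: (emeasurable_poweR b (emeasurable_poweR s mg1)).
  apply: aeW => y; apply: filterS (Fg y) => z Fyz.
  by rewrite poweRe0 !mul1e -poweRrM mulVf ?gt_eqF// poweRe1.
- by rewrite poweRe0 !mul1e pE LnormE invrK.
Qed.

End mixed_norm_pair.

(** * Majorants on the whole product *)

Lemma ae_restr_pair (R : realType) (I : finType) (d : I -> measure_display)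
    (X : forall i, measurableType (d i))
    (mu : forall i, {sigma_finite_measure set (X i) -> \bar R})
    (E : {set I}) (P : subproduct X E * subproduct X (~: E) -> Prop) :
  {ae subproduct_measure mu E \x subproduct_measure mu (~: E),
    forall yz, P yz} ->
  {ae product_measure mu, forall x, P (restr E x, restr (~: E) x)}.
Proof.
move=> [N [mN N0 PN]].
pose split (x : product_space X) := (restr E x, restr (~: E) x).
have msplit : measurable_fun setT split.
  by apply: measurable_fun_pair; exact: measurable_restr.
have mpN : measurable (split @^-1` N).
  by rewrite -[X in measurable X]setTI; exact: msplit.
exists (split @^-1` N); split => //; last by move=> x; exact: PN.
(* The integral identity for pairs, applied to the indicator of [N], shows that the preimage of [N]
   is null. *)
have mU : measurable_fun setT (fun yz => (\1_N yz)%:E : \bar R).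
  exact/measurable_EFinP/measurable_indic.
have := integral_restr_pair mu mU (fun yz => ltac:(by rewrite lee_fin)).
rewrite !integral_indic// !setIT => intN.
exact: etrans intN N0.
Qed.

(** Prepares the majorant for Finner's inequality: [W] lives on the whole product but ignores the
    coordinates outside [E], and the integral of [w] becomes a marginal over those in [E]. *)
Lemma mixed_norm_majorant_product (R : realType) (I : finType)
    (d : I -> measure_display) (X : forall i, measurableType (d i))
    (mu : forall i, {sigma_finite_measure set (X i) -> \bar R})
    (E : {set I}) (s : seq I) (f : product_space X -> \bar R)
    (q p : \bar R) (a b : R) :
  uniq s -> (forall j, j \in s) ->
  measurable_fun setT f -> (forall x, 0 <= f x) ->
  (0 <= a)%R -> (0 <= b)%R -> q^-1 = a%:E -> p^-1 = (a + b)%:E ->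
  exists (C : \bar R) (U W : product_space X -> \bar R),
  [/\ [/\ 0 <= C,
          measurable_fun setT U /\ (forall x, 0 <= U x) &
          measurable_fun setT W /\ (forall x, 0 <= W x)],
      forall x j (t : X j), j \notin E -> W (update x t) = W x,
      {ae product_measure mu, forall x, f x <= C * (U x `^ a * W x `^ b)} &
      C * ((\int[product_measure mu]_x U x) `^ a *
           (marginals mu [seq j <- s | j \in E] W point) `^ b) <=
        mixed_norm mu E q p f].
Proof.
move=> us sT mf f0 a0 b0 qa pab.
have mF : measurable_fun setT
    (fun yz : subproduct X E * subproduct X (~: E) => f (Defs.glue yz.1 yz.2)).
  by apply: (measurableT_comp mf); exact: measurable_glue.
have [C [u [w [C0 [mu0 u0] [mw w0] ae le]]]] :=
  mixed_norm_majorant (subproduct_measure mu E) (subproduct_measure mu (~: E))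
    mF (fun=> f0 _) a0 b0 qa pab.
exists C, (fun x => u (restr E x, restr (~: E) x)), (w \o restr E).
split=> [|x j t jE||].
- split; [exact: C0|split; last by move=> x; exact: u0|].
    apply: (measurableT_comp mu0).
    by apply: measurable_fun_pair; exact: measurable_restr.
  split; last by move=> x; exact: w0.
  exact: (measurableT_comp mw (@measurable_restr _ _ X E)).
- by rewrite /= restr_update_out.
- by apply: filterS (ae_restr_pair ae) => x /=; rewrite glue_restr.
- rewrite (integral_restr_pair _ mu0 u0).
  by rewrite -(integral_subproduct _ _ us sT mw w0).
Qed.

(** * Combination of the majorants with Finner's inequality *)

Theorem theorem5p3 (R : realType) (n k : nat)
    (d : 'I_n -> measure_display)
    (X : forall j : 'I_n, measurableType (d j))
    (mu : forall j : 'I_n, {sigma_finite_measure set (X j) -> \bar R})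
    (hk : (0 < k < n)%N)
    (S : 'I_('C(n, k)) -> {set 'I_n})
    (S_inj : injective S)
    (S_enum : forall A : {set 'I_n}, #|A| = k <-> exists i, S i = A)
    (q : 'I_('C(n, k)) -> \bar R)
    (q_gt0 : forall i, 0 < q i)
    (q_sum : \sum_i (q i)^-1 <= 1)
    (eps : \bar R)
    (epsE : eps = 1 - \sum_i (q i)^-1)
    (c : 'I_('C(n, k)) -> R)
    (c_ge0 : forall i, (0 <= c i)%R)
    (c_sum : forall j : 'I_n, (\sum_(i | j \in S i) c i = 1)%R)
    (p : 'I_('C(n, k)) -> \bar R)
    (pE : forall i, (p i)^-1 = (q i)^-1 + (c i)%:E * eps)
    (f : 'I_('C(n, k)) -> product_space X -> \bar R)
    (f_meas : forall i, measurable_fun [set: product_space X]%classic (f i))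
    (f_ge0 : forall i x, 0 <= f i x) :
  \int[product_measure mu]_x (\prod_i f i x)
    <= \prod_i mixed_norm mu (S i) (q i) (p i) (f i).
Proof.
have qV0 i : 0 <= (q i)^-1 by rewrite inve_ge0 ltW.
(* Each inverse is at most the whole sum, hence at most [1]; from here on the inverse exponents are
   real numbers. *)
have qV_fin i : (q i)^-1 \is a fin_num.
  rewrite ge0_fin_numE//; apply: (@le_lt_trans _ _ 1); last exact: ltry.
  apply: le_trans q_sum; rewrite (bigD1 i)//= leeDl//.
  by apply: sume_ge0 => j _.
pose a i := fine (q i)^-1.
have qVE i : (q i)^-1 = (a i)%:E by rewrite fineK.
have a0 i : (0 <= a i)%R by exact: fine_ge0.
pose e := (1 - \sum_i a i)%R.
have sumqE : \sum_i (q i)^-1 = (\sum_i a i)%:E.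
  by rewrite -sumEFin; apply: eq_bigr => i _.
have e0 : (0 <= e)%R by rewrite subr_ge0 -lee_fin -sumqE.
have epsEe : eps = e%:E by rewrite epsE sumqE.
have b0 i : (0 <= c i * e)%R by exact: mulr_ge0.
have pVE i : (p i)^-1 = (a i + c i * e)%:E by rewrite pE epsEe qVE.
have [s us sT] : exists2 s : seq 'I_n, uniq s & forall j, j \in s.
  by exists (enum 'I_n); [exact: enum_uniq|move=> j; rewrite mem_enum].
have /choice[C /choice[U /choice[W maj]]] := fun i =>
  mixed_norm_majorant_product mu (S i) us sT (f_meas i) (f_ge0 i)
    (a0 i) (b0 i) (qVE i) (pVE i).
have C0 i : 0 <= C i by have [[]] := maj i.
have mU i : measurable_fun setT (U i) by have [[_ []]] := maj i.
have U0 i x : 0 <= U i x by have [[_ []]] := maj i.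
have mW i : measurable_fun setT (W i) by have [[_ _ []]] := maj i.
have W0 i x : 0 <= W i x by have [[_ _ []]] := maj i.
(* Finner's inequality is used for twice as many functions: the left copy indexes the [U i], on all
   coordinates, the right copy the [W i], on those in [S i]. *)
pose A (l : 'I_('C(n, k)) + 'I_('C(n, k))) :=
  match l with inl _ => [set: 'I_n]%SET | inr i => S i end.
pose w l := match l with inl i => a i | inr i => (c i * e)%R end.
pose F l := match l with inl i => U i | inr i => W i end.
have w0 l : (0 <= w l)%R by case: l => i /=.
(* At coordinate [j] the left copy contributes the sum of the [a i], and the right copy contributes
   [e] because the [c i] with [j \in S i] add up to [1]. *)
have w1 j : (\sum_(l | j \in A l) w l = 1)%R.
  rewrite big_sumType /= -mulr_suml c_sum mul1r.
  by rewrite (eq_bigl xpredT) => [|i]; rewrite ?inE// addrC subrK.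
have mF l : measurable_fun setT (F l).
  by case: l => i; [exact: mU|exact: mW].
have F0 l x : 0 <= F l x by case: l => i; [exact: U0|exact: W0].
have igF l x j (t : X j) : j \notin A l -> F l (update x t) = F l x.
  by case: l => i /=; [rewrite inE|have [_ igW _ _] := maj i; exact: igW].
pose G x := \prod_l F l x `^ w l.
have mG : measurable_fun setT G.
  by apply: emeasurable_prod => l; exact: emeasurable_poweR.
have G0 x : 0 <= G x by apply: prode_ge0 => l _; exact: poweR_ge0.
have GE x : \prod_i (C i * (U i x `^ a i * W i x `^ (c i * e))) =
    \prod_i C i * G x.
  by rewrite !big_split /G big_sumType.
have pC0 : 0 <= \prod_i C i by exact: prode_ge0.
apply: (@le_trans _ _ (\int[product_measure mu]_x (\prod_i C i * G x))).
  apply: ae_ge0_le_integral => //.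
  - by move=> x _; exact: prode_ge0.
  - exact: emeasurable_prod.
  - by move=> x _; exact: mule_ge0.
  - exact: measurable_funeM.
  (* The finitely many exceptional null sets are merged into one. *)
  have : {ae product_measure mu, forall x i,
      f i x <= C i * (U i x `^ a i * W i x `^ (c i * e))}.
    apply: filter_forall => i.
    by have [] := maj i.
  apply: filterS => x fx _; rewrite -GE; apply: lee_prod => i.
  by rewrite f_ge0 fx.
rewrite ge0_integralZl//.
apply: (@le_trans _ _ (\prod_i C i *
    \prod_l (marginals mu [seq j <- s | j \in A l] (F l) point) `^ w l)).
  apply: lee_wpmul2l => //.
  rewrite (integral_product_measure mu point us sT mG G0).
  exact: finner_marginals.
(* Regrouping the two copies index by index leaves exactly the norm bound given by each majorant. *)
rewrite big_sumType /= -!big_split; apply: lee_prod => i.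
apply/andP; split; first by rewrite !mule_ge0 ?poweR_ge0.
have [_ _ _] := maj i; congr (_ * (_ `^ _ * _) <= _).
rewrite (integral_product_measure mu point us sT (mU i) (U0 i)).
congr marginals; rewrite (eq_filter (a2 := xpredT)) ?filter_predT// => j.
by rewrite inE.
Qed.
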